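(* Let $n\ge 1$ be an integer, let $E$ be a Banach space and let $\tau$ be a Hausdorff topology on $E$. Let $\{T(p): p\in\mathbb{R}_+^n\}$ be an $n$-parameter $\tau$-continuous semigroup of mappings on a subset $C$ of $E$. Let $p_1,\dots,p_n\in\mathbb{R}_+^n$ be linearly independent (over $\mathbb{R}$, in the usual sense). Let $\alpha_1,\dots,\alpha_n\in\mathbb{R}$ be such that $\{1,\alpha_1,\dots,\alpha_n\}$ is linearly independent over $\mathbb{Q}$ and $$p_0=\alpha_1p_1+\alpha_2p_2+\cdots+\alpha_np_n\in\mathbb{R}_+^n.$$ Then $$\bigcap_{p\in\mathbb{R}_+^n}F\big(T(p)\big)=F\big(T(p_0)\big)\cap F\big(T(p_1)\big)\cap\cdots\cap F\big(T(p_n)\big).$$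
   Context: $\mathbb{R}_+^n=[0,\infty)^n$. For a mapping $T$ on $C$, $F(T)=\{x\in C: Tx=x\}$ is its set of fixed points. A family $\{T(p): p\in\mathbb{R}_+^n\}$ of mappings from $C$ into $C$ is an $n$-parameter $\tau$-continuous semigroup of mappings on $C$ if (sg 1) $T(p+q)=T(p)\circ T(q)$ for all $p,q\in\mathbb{R}_+^n$; and (sg 2) for each $x\in C$, the map $p\mapsto T(p)x$ from $\mathbb{R}_+^n$ into $C$ is continuous with respect to $\tau$. (It is not assumed that $T(0)$ is the identity.) Real numbers $\{\gamma_1,\dots,\gamma_m\}$ are linearly independent over $\mathbb{Q}$ if there is no nonzero $(\nu_1,\dots,\nu_m)\in\mathbb{Z}^m$ with $\nu_1\gamma_1+\cdots+\nu_m\gamma_m=0$. *)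

(* Defs.v *)
From HB Require Import structures.
From mathcomp Require Import all_boot all_order all_algebra.
From mathcomp Require Import all_classical all_reals all_analysis.
Import Order.TTheory GRing.Theory Num.Theory.
Import numFieldNormedType.Exports.

Set Implicit Arguments.
Unset Strict Implicit.
Unset Printing Implicit Defensive.

Local Open Scope classical_set_scope.
Local Open Scope ring_scope.

Definition orthant (R : realType) (n : nat) : set 'rV[R]_n :=
  [set p | forall i : 'I_n, 0 <= p ord0 i].
Arguments orthant : clear implicits.

(* The carrier E endowed with the topology tau. When E also has a norm, tau is
   a second, unrelated topology: continuity and separation with respect to tau
   must be stated at this type, since at type E they would refer to the norm. *)
Definition retopologize (E : Type) (tau : Topological E) : topologicalType :=
  Topological.Pack tau.

(* T is a total function; only the values T p x with p in the orthant and x in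
   C are constrained. T 0 need not be the identity on C. *)
Record is_semigroup (R : realType) (n : nat) (E : Type) (tau : Topological E)
    (C : set E) (T : 'rV[R]_n -> E -> E) : Prop := IsSemigroup {
  semigroup_stable : forall p x, orthant R n p -> C x -> C (T p x) ;
  semigroup_add : forall p q, orthant R n p -> orthant R n q ->
    forall x, C x -> T (p + q) x = T p (T q x) ;
  semigroup_continuous : forall x, C x ->
    {within orthant R n, continuous (fun p => T p x : retopologize tau)} }.

Definition fixed_points (E : Type) (C : set E) (f : E -> E) : set E :=
  [set x | C x /\ f x = x].

Definition rat_independent (R : realType) (m : nat) (gamma : m.-tuple R) : Prop :=
  ~ exists2 nu : 'rV[int]_m, nu != 0 &
      \sum_(i < m) (nu ord0 i)%:~R * tnth gamma i = 0.

(* Main.v *)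
Require Import Defs.
From HB Require Import structures.
From mathcomp Require Import all_boot all_order all_algebra.
From mathcomp Require Import all_classical all_reals all_analysis.
From mathcomp Require Import lra.
Import Order.TTheory GRing.Theory Num.Theory.
Import numFieldNormedType.Exports.

Set Implicit Arguments.
Unset Strict Implicit.
Unset Printing Implicit Defensive.

Local Open Scope classical_set_scope.
Local Open Scope ring_scope.

(* If x is fixed by T(p_0), ..., T(p_n), then p |-> T(p) x is invariant under
   translation by the subgroup G generated by the p_i, so it equals x on the
   elements of G lying in the orthant.  G is dense (Kronecker): a subgroup of
   R^n that is not dense carries a nonzero linear form L with integer values,
   and L(p_0) = sum_i alpha_i L(p_i) with integers L(p_i) contradicts the
   independence of 1, alpha_1, ..., alpha_n over Q.  The form L is found by
   induction on n, projecting along a nearly shortest vector if G is discrete,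
   and along a line contained in the closure of G otherwise.  Continuity and
   the Hausdorff property then give T(q) x = x on the whole orthant. *)

(** * Subgroups of R^n and integral linear forms *)

Definition is_subgroup (V : zmodType) (G : set V) : Prop :=
  G 0 /\ forall x y, G x -> G y -> G (x - y).

Lemma subgroupD (V : zmodType) (G : set V) x y :
  is_subgroup G -> G x -> G y -> G (x + y).
Proof.
move=> [G0 GB] Gx Gy; have GNy : G (- y) by rewrite -sub0r; exact: GB.
by rewrite -[y]opprK; exact: GB.
Qed.

Lemma subgroupMz (V : zmodType) (G : set V) x (m : int) :
  is_subgroup G -> G x -> G (x *~ m).
Proof.
move=> sG Gx; have Gnat (k : nat) : G (x *+ k).
  elim: k => [|k IHk]; first by rewrite mulr0n; exact: sG.1.
  by rewrite mulrS; apply: subgroupD.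
case: m => k; first exact: Gnat.
by rewrite NegzE mulrNz -sub0r; apply: sG.2; [exact: sG.1 | exact: Gnat].
Qed.

Lemma subgroup_mulmx (R : realType) m n (B : 'M[R]_(m, n)) (G : set 'rV[R]_m) :
  is_subgroup G -> is_subgroup [set g *m B | g in G].
Proof.
move=> [G0 GB]; split; first by exists 0; rewrite ?mul0mx.
move=> _ _ [x Gx <-] [y Gy <-]; exists (x - y); first exact: GB.
by rewrite mulmxBl.
Qed.

Definition integral_on (R : realType) n (G : set 'rV[R]_n) (L : 'cV[R]_n) : Prop :=
  forall g, G g -> (g *m L) 0 0 \is a Num.int.

Lemma coord_le_norm (R : realType) n (v : 'rV[R]_n) i : `|v 0 i| <= `|v|.
Proof.
rewrite [leRHS]/Num.Def.normr /= mx_normrE.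
by apply/bigmax_geP; right; exists (0, i).
Qed.

Lemma norm_le_coord (R : realType) n (v : 'rV[R]_n) (e : R) :
  0 <= e -> (forall i, `|v 0 i| <= e) -> `|v| <= e.
Proof.
move=> e0 ve; rewrite [leLHS]/Num.Def.normr /= mx_normrE.
by apply: bigmax_le => // -[i j] _; rewrite ord1.
Qed.

(** Choose [j] with [u 0 j != 0]. The form [c] is [v 0 j / u 0 j]; [B] subtracts that multiple of
    [u] and deletes coordinate [j]; [S] reinserts a zero there, which cannot increase the sup
    norm. *)
Lemma projection_along (R : realType) n (u : 'rV[R]_n.+1) : u != 0 ->
  exists (B : 'M[R]_(n.+1, n)) (S : 'M[R]_(n, n.+1)) (c : 'cV[R]_n.+1),
    [/\ u *m B = 0, (u *m c) 0 0 = 1, S *m B = 1%:M,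
        forall v : 'rV_n.+1, v = v *m B *m S + (v *m c) 0 0 *: u &
        forall w : 'rV_n, `|w *m S| <= `|w|].
Proof.
move=> /rV0Pn[j uj0].
pose c : 'cV[R]_n.+1 := (u 0 j)^-1 *: delta_mx j 0.
pose A : 'M[R]_n.+1 := 1%:M - c *m u.
pose S : 'M[R]_(n, n.+1) := row' j 1%:M.
have vc (v : 'rV[R]_n.+1) : (v *m c) 0 0 = v 0 j / u 0 j.
  rewrite mxE (bigD1 j) //= big1 => [|k kj]; rewrite !mxE ?eqxx.
    by rewrite mulr1 addr0.
  by rewrite (negPf kj) /= !mulr0.
have wS (w : 'rV[R]_n) k : (w *m S) 0 k = if unlift j k is Some k' then w 0 k' else 0.
  rewrite mxE; case: unliftP => [k' ->|->].
    rewrite (bigD1 k') //= big1 => [|i ik]; rewrite !mxE.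
      by rewrite eqxx mulr1 addr0.
    by rewrite (inj_eq lift_inj) (negPf ik) mulr0.
  by rewrite big1 // => i _; rewrite !mxE eq_sym (negPf (neq_lift j i)) mulr0.
have vA (v : 'rV[R]_n.+1) : v *m A = v - (v *m c) 0 0 *: u.
  by rewrite mulmxBr mulmx1 mulmxA [v *m c]mx11_scalar mul_scalar_mx !mxE.
have vB (v : 'rV[R]_n.+1) : v *m col' j A = col' j (v *m A).
  by apply/rowP => k; rewrite !mxE; apply: eq_bigr => i _; rewrite !mxE.
exists (col' j A), S, c; split.
- by rewrite vB vA vc divff // scale1r subrr; apply/rowP => k; rewrite !mxE.
- by rewrite vc divff.
- apply/row_matrixP => i; rewrite row_mul vB vA vc; apply/rowP => k.
  by rewrite !mxE lift_eqF mulr0n !mul0r subr0 (inj_eq lift_inj).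
- move=> v; apply/rowP => k; rewrite mxE wS vB vA vc.
  case: unliftP => [k' ->|->]; rewrite !mxE ?subrK //.
  by rewrite add0r divfK.
- move=> w; apply: norm_le_coord => // k; rewrite wS.
  by case: unlift => [k'|]; rewrite ?normr0 // coord_le_norm.
Qed.

(** The infimum of the nonzero lengths is at least [e], hence positive, so some length lies below
    4/3 of it; whether the infimum is attained does not matter. *)
Lemma near_shortest (R : realType) n (G : set 'rV[R]_n) (e : R) u0 :
  0 < e -> (forall g, G g -> g != 0 -> e <= `|g|) -> G u0 -> u0 != 0 ->
  exists u, [/\ G u, u != 0 &
    forall g, G g -> g != 0 -> 3 / 4 * `|u| <= `|g|].
Proof.
move=> e0 Ge Gu0 u00; pose D := [set `|g| | g in [set g | G g /\ g != 0]].
have Dlb : lbound D e by move=> _ [g [Gg g0] <-]; exact: Ge.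
have Dinf : has_inf D by split; [exists `|u0|, u0 | exists e].
have infD : e <= inf D by apply: lb_le_inf => //; exact: Dinf.1.
have [_ [u [Gu un0] <-] ulow] : exists2 r, D r & r < inf D + inf D / 3.
  by apply: inf_adherent => //; lra.
exists u; split=> // g Gg g0.
have : inf D <= `|g| by apply: ge_inf; [exact: Dinf.2 | exists g].
lra.
Qed.

Lemma round_half (R : realType) (t : R) : exists m : int, `|t - m%:~R| <= 1 / 2.
Proof.
exists (Num.floor (t + 1 / 2)).
have /andP[] := floor_itv (t + 1 / 2); rewrite intrD ler_norml => h1 h2.
apply/andP; split; lra.
Qed.

(* Projecting along an almost shortest vector [u] keeps the subgroup discrete:
   a vector of G can be shifted by a multiple of u until its component along u
   is at most [`|u| / 2], and then a short projection would make it shorter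
   than u. *)
Lemma discrete_subgroup_integral (R : realType) n (G : set 'rV[R]_n) (e : R) :
  (0 < n)%N -> is_subgroup G -> 0 < e ->
  (forall g, G g -> g != 0 -> e <= `|g|) ->
  exists2 L, L != 0 & integral_on G L.
Proof.
elim: n G e => [//|n IHn] G e _ sG e0 Ge.
have [[u0 [Gu0 u00]]|noG] := pselect (exists u0, G u0 /\ u0 != 0); last first.
  (* On the trivial group every form is integral, so any nonzero one will do. *)
  exists (const_mx 1).
    by apply/eqP => /matrixP/(_ 0 0); rewrite !mxE; apply/eqP/oner_neq0.
  move=> g Gg; have -> : g = 0.
    by apply/eqP/negPn/negP => g0; apply: noG; exists g.
  by rewrite mul0mx mxE.
have [u [Gu un0 Gshort]] := near_shortest e0 Ge Gu0 u00.
have u_gt0 : 0 < `|u| by rewrite normr_gt0.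
have [B [S [c [uB uc SB vE Snorm]]]] := projection_along un0.
have reduce g : G g -> exists m : int, g = m%:~R *: u \/ `|u| / 4 <= `|g *m B|.
  move=> Gg; have [m mP] := round_half ((g *m c) 0 0); exists m.
  have [/eqP|gm0] := eqVneq (g - m%:~R *: u) 0.
    by rewrite subr_eq0 => /eqP; left.
  right; have : 3 / 4 * `|u| <= `|g *m B| + 1 / 2 * `|u|; last lra.
  apply: (le_trans (Gshort _ _ gm0)).
    by apply: sG.2 => //; rewrite scaler_int; exact: subgroupMz.
  rewrite {1}(vE g) -addrA -scalerBl.
  apply: (le_trans (ler_normD _ _)); apply: lerD; first exact: Snorm.
  by rewrite normrZ ler_wpM2r.
(* In dimension one the projection is zero, so every element of [G] is an integer multiple of [u]
   and the coordinate [c] along [u] is integral. *)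
have [n0|n_gt0] := posnP n.
  exists c.
    by apply: contra_eq_neq uc => ->; rewrite mulmx0 mxE eq_sym oner_eq0.
  move=> g Gg; have [m [->|]] := reduce g Gg.
    by rewrite -scalemxAl mxE uc mulr1 intr_int.
  have -> : g *m B = 0.
    by apply/rowP => i; have := ltn_ord i; rewrite [X in (_ < X)%N]n0.
  by rewrite normr0; lra.
pose G' := [set g *m B | g in G].
have sG' : is_subgroup G' := subgroup_mulmx B sG.
have [||L L0 Lint] := IHn G' (`|u| / 4) n_gt0 sG'; first lra.
  move=> _ [g Gg <-] gB0; have [m [gE|//]] := reduce g Gg.
  by move: gB0; rewrite gE -scalemxAl uB scaler0 eqxx.
exists (B *m L).
  by apply: contra_neq L0 => BL; rewrite -(mul1mx L) -SB -mulmxA BL mulmx0.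
by move=> g Gg; rewrite mulmxA; apply: Lint; exists g.
Qed.

(* By compactness of the unit sphere, the directions of arbitrarily short
   nonzero vectors g of G accumulate at some u; the integer multiples of such a
   g then approximate the whole line spanned by u. *)
Lemma short_vectors_line (R : realType) n (G : set 'rV[R]_n) :
  is_subgroup G ->
  (forall e : R, 0 < e -> exists g, [/\ G g, g != 0 & `|g| < e]) ->
  exists2 u, u != 0 & forall t e : R, 0 < e -> exists2 g, G g & `|t *: u - g| < e.
Proof.
move=> sG Gshort.
have /choice[f fP] (k : nat) : exists g, [/\ G g, g != 0 & `|g| < k.+1%:R^-1].
  by apply: Gshort; rewrite invr_gt0 ltr0n.
pose w k := `|f k|^-1 *: f k; pose A := [set v : 'rV[R]_n | `|v| = 1].
have fn0 k : `|f k| != 0 by rewrite normr_eq0; have [] := fP k.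
have wA k : A (w k) by rewrite /A /= /w normrZ normfV normr_id mulVf.
have Acompact : compact A.
  apply: bounded_closed_compact.
    by exists 1; split=> // r r1 v /= ->; exact: ltW.
  apply: (@preimage_closed _ _ (fun v : 'rV[R]_n => `|v|) [set 1]) => [v _|].
    exact: norm_continuous.
  exact: closed_eq.
have wnearA : (w @ \oo) A by exists 0%N => // k _; exact: wA.
have [u [Au ucl]] := Acompact _ (fmap_proper_filter w eventually_filter) wnearA.
exists u; first by rewrite -normr_gt0 Au.
(* With this [d], the error in the direction costs at most [e / 2] after scaling by [t], and
   rounding costs at most half of [f k], which is shorter than [e]. The [+ 1] covers [t = 0]. *)
move=> t e e0; pose d := e / 2 / (`|t| + 1).
have t1 : 0 < `|t| + 1 by rewrite ltr_wpDl.
have d0 : 0 < d by rewrite !divr_gt0.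
have tde : (`|t| + 1) * d = e / 2 by rewrite mulrC divfK // gt_eqF.
have wsmall : (w @ \oo) [set w k | k in [set k | k.+1%:R^-1 < e]].
  have [N _ Ne] := near_infty_natSinv_lt (PosNum e0).
  by exists N => // k /Ne ke; exists k.
have [_ [[k ke <-] uw]] := ucl _ (ball u d) wsmall (nbhsx_ballx u d d0).
have [Gf _ fk] := fP k; have [m mP] := round_half (t / `|f k|).
exists (m%:~R *: f k); first by rewrite scaler_int; exact: subgroupMz.
have -> : t *: u - m%:~R *: f k = t *: (u - w k) + (t / `|f k| - m%:~R) *: f k.
  by rewrite scalerBr scalerBl /w scalerA addrA subrK.
apply: le_lt_trans (ler_normD _ _) _; rewrite !normrZ.
move: uw; rewrite -ball_normE /ball_ /= => uw.
have h1 : `|t| * `|u - w k| <= `|t| * d by rewrite ler_wpM2l // ltW.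
have h2 : `|t / `|f k| - m%:~R| * `|f k| <= 1 / 2 * `|f k| by rewrite ler_wpM2r.
apply: (le_lt_trans (lerD h1 h2)).
move: (lt_trans fk ke) tde; rewrite mulrDl mul1r; move: d0; clear; clearbody d; lra.
Qed.

(** * Density of subgroups of R^n *)

Lemma subgroup_dense (R : realType) n (G : set 'rV[R]_n) :
  is_subgroup G -> (forall L, integral_on G L -> L = 0) ->
  forall (v : 'rV[R]_n) (e : R), 0 < e -> exists2 g, G g & `|v - g| < e.
Proof.
elim: n G => [|n IHn] G sG GL v e e0.
  by exists 0; [exact: sG.1 | rewrite (thinmx0 (v - 0)) normr0].
have [[d [d0 Gd]]|short] :=
    pselect (exists d, 0 < d /\ forall g, G g -> g != 0 -> d <= `|g|).
  have [//|L L0 /GL LE] := discrete_subgroup_integral _ sG d0 Gd.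
  by rewrite LE eqxx in L0.
have [|u un0 Gline] := short_vectors_line sG.
  move=> d d0; apply: contrapT => nog; apply: short; exists d; split=> // g Gg g0.
  by rewrite leNgt; apply/negP => gd; apply: nog; exists g.
have [B [S [c [uB _ SB vE Snorm]]]] := projection_along un0.
pose G' := [set g *m B | g in G].
(* Forms integral on the projection pull back along [B] to forms integral on [G]; [S] shows that the
   pullback is injective. *)
have G'L L : integral_on G' L -> L = 0.
  move=> Lint; rewrite -(mul1mx L) -SB -mulmxA (GL (B *m L)) ?mulmx0 // => g Gg.
  by rewrite mulmxA; apply: Lint; exists g.
have e2 : 0 < e / 2 by lra.
have [_ [g Gg <-] vg] := IHn G' (subgroup_mulmx B sG) G'L (v *m B) _ e2.
(* What [g] leaves uncontrolled is the component of [v - g] along [u], and [g'] corrects it. *)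
have [g' Gg' tg'] := Gline (((v - g) *m c) 0 0) _ e2.
exists (g + g'); first exact: subgroupD.
rewrite opprD addrA {1}(vE (v - g)) -addrA.
apply: le_lt_trans (ler_normD _ _) _.
by rewrite [ltRHS]splitr ltrD // (le_lt_trans (Snorm _)) // mulmxBl.
Qed.

Lemma orthogonal_to_basis_eq0 (R : realType) n (p : n.-tuple 'rV[R]_n) (L : 'cV[R]_n) :
  free p -> (forall i, tnth p i *m L = 0) -> L = 0.
Proof.
move=> pfree pL.
have pbasis : basis_of fullv p.
  by rewrite basisEfree pfree subvf size_tuple dimvf /= /dim /= mul1n leqnn.
suff rowL (v : 'rV[R]_n) : v *m L = 0.
  by apply/row_matrixP => i; rewrite -[L]mul1mx row_mul rowL row0.
rewrite (coord_basis pbasis (memvf v)) mulmx_suml big1 // => i _.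
by rewrite -scalemxAl -tnth_nth pL scaler0.
Qed.

Lemma basis_generates_dense (R : realType) n (p : n.-tuple 'rV[R]_n)
    (alpha : n.-tuple R) (G : set 'rV[R]_n) :
  free p -> rat_independent [tuple of 1 :: alpha] ->
  is_subgroup G -> (forall i, G (tnth p i)) ->
  G (\sum_(i < n) tnth alpha i *: tnth p i) ->
  forall (v : 'rV[R]_n) (e : R), 0 < e -> exists2 g, G g & `|v - g| < e.
Proof.
move=> pfree alphaQ sG Gp Gp0; apply: subgroup_dense => // L Lint.
have /choice[k kE] i : exists k : int, (tnth p i *m L) 0 0 = k%:~R.
  exact/intrP/Lint.
have /intrP[k0] := Lint _ Gp0.
rewrite mulmx_suml summxE => k0E.
apply: (orthogonal_to_basis_eq0 pfree) => i.
rewrite [LHS]mx11_scalar kE; apply/eqP; apply: contra_notT alphaQ => ki.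
(* The relation [k0 = sum_j k j * alpha_j]: index 0, where [unlift] gives [None], carries the
   coefficient [- k0] of 1. *)
exists (\row_j oapp k (- k0) (unlift 0 j)).
  apply/rV0Pn; exists (lift 0 i); rewrite mxE liftK /=.
  by apply: contraNneq ki => ->; rewrite mulr0z raddf0.
rewrite big_ord_recl !mxE unlift_none /= mulr1 mulrNz -k0E.
under [X in _ + X]eq_bigr => j _ do rewrite mxE liftK /= tnthS -kE mulrC.
apply/eqP; rewrite addrC subr_eq0; apply/eqP/eq_bigr => j _.
by rewrite -scalemxAl [in RHS]mxE.
Qed.

(** * Periods of the orbit of a point *)

Section SemigroupPeriods.
Variables (R : realType) (n : nat) (E : Type) (tau : Topological E).
Variables (C : set E) (T : 'rV[R]_n -> E -> E) (x : E).
Hypotheses (hT : is_semigroup tau C T) (Cx : C x).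

Definition stabilizer : set 'rV[R]_n := [set v | orthant R n v /\ T v x = x].

Lemma orthantD (u v : 'rV[R]_n) : orthant R n u -> orthant R n v -> orthant R n (u + v).
Proof. by move=> u0 v0 i; rewrite mxE addr_ge0. Qed.

Lemma stabilizerD u v : stabilizer u -> stabilizer v -> stabilizer (u + v).
Proof.
move=> [u0 ux] [v0 vx]; split; first exact: orthantD.
by rewrite (semigroup_add hT) // vx.
Qed.

(** T(u) x = T(u) T(v) x = T(u + v) x = x, so no inverse of T(v) is required. *)
Lemma stabilizer_cancel u v :
  orthant R n u -> stabilizer v -> stabilizer (u + v) -> stabilizer u.
Proof.
by move=> u0 [v0 vx] [_ uvx]; split=> //; rewrite -{2}uvx (semigroup_add hT) // vx.
Qed.

(** As [T 0] may differ from the identity, this comes from cancelling [v] in [0 + v]. *)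
Lemma stabilizer0 v : stabilizer v -> stabilizer 0.
Proof.
move=> sv; apply: (stabilizer_cancel _ sv); last by rewrite add0r.
by move=> i; rewrite mxE.
Qed.

(** The group generated by the monoid [stabilizer]; differences are used because [T] is only
    constrained on the orthant. *)
Definition periods : set 'rV[R]_n := [set a.1 - a.2 | a in stabilizer `*` stabilizer].

Lemma periods_subgroup v : stabilizer v -> is_subgroup periods.
Proof.
move=> /stabilizer0 s0; split; first by exists (0, 0); rewrite ?subr0.
move=> _ _ [[a b] [/= sa sb] <-] [[c d] [/= sc sd] <-].
exists (a + d, b + c); first by split; exact: stabilizerD.
by rewrite /= opprB opprD addrACA.
Qed.

Lemma stabilizer_periods v : stabilizer v -> periods v.
Proof. by move=> sv; exists (v, 0); rewrite ?subr0 //; split=> //; exact: stabilizer0 sv. Qed.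

Lemma periods_orthant v : periods v -> orthant R n v -> stabilizer v.
Proof.
move=> [[a b] [/= sa sb] <-] ab; apply: (stabilizer_cancel ab sb).
by rewrite subrK.
Qed.

(** If T(q) x differed from x, disjoint open sets would separate them; by continuity some [v] of the
    stabilizer near [q] would put x = T(v) x in both. *)
Lemma stabilizer_closed q : hausdorff_space (retopologize tau) -> orthant R n q ->
  (forall e : R, 0 < e -> exists2 v, stabilizer v & `|q - v| < e) -> stabilizer q.
Proof.
move=> haus q0 qlim; split=> //; apply: contrapT => qx.
have {}qx : (T q x : retopologize tau) != x by apply/eqP.
have := haus; rewrite open_hausdorff => /(_ (T q x) x qx).
move=> [[A B] /= [/set_mem qA /set_mem xB] [oA _ /eqP AB0]].
have /subspace_continuousP/(_ q q0) := semigroup_continuous hT Cx.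
move=> /(_ A (open_nbhs_nbhs (conj oA qA))) /nbhs_ballP[e /= e0 qeA].
have [v [v0 vx] qv] := qlim e e0.
have Ax : A x by rewrite -vx; apply: qeA => //; rewrite -ball_normE.
by rewrite -[False]/(set0 x) -AB0.
Qed.
End SemigroupPeriods.

(** * Approximation from inside the orthant *)

(** If coordinate [j] of the sum is zero, nonnegativity makes it zero on each vector of the basis,
    so the [j]-th coordinate form would vanish. *)
Lemma basis_sum_gt0 (R : realType) n (p : n.-tuple 'rV[R]_n) : free p ->
  (forall i, orthant R n (tnth p i)) -> forall j, 0 < (\sum_i tnth p i) 0 j.
Proof.
move=> pfree p0 j; rewrite summxE lt_neqAle sumr_ge0 => [|i _]; last exact: p0.
rewrite andbT; apply/negP => /eqP/esym sum0.
have pj : delta_mx j 0 = 0 :> 'cV[R]_n.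
  apply: (orthogonal_to_basis_eq0 pfree) => i; rewrite -colE.
  have /eqP := sum0; rewrite psumr_eq0 => [/allP/(_ i)|k _]; last exact: p0.
  rewrite mem_index_enum => /(_ isT)/eqP pij.
  by apply/matrixP => a b; rewrite !mxE ord1.
by move/matrixP/(_ j 0): pj; rewrite !mxE !eqxx; apply/eqP/oner_neq0.
Qed.

(* Shifting v slightly towards the interior of the orthant, by a multiple of b,
   leaves room for the approximating element of G. *)
Lemma dense_in_orthant (R : realType) n (G : set 'rV[R]_n) (b : 'rV[R]_n) :
  (forall (v : 'rV[R]_n) (e : R), 0 < e -> exists2 g, G g & `|v - g| < e) -> (forall j, 0 < b 0 j) ->
  forall v (e : R), orthant R n v -> 0 < e ->
  exists g, [/\ G g, orthant R n g & `|v - g| < e].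
Proof.
move=> Gdense b0 v e v0 e0.
have bn : 0 < `|b| + 1 by rewrite ltr_wpDl.
pose t := e / 2 / (`|b| + 1).
have t0 : 0 < t by rewrite !divr_gt0.
have tbe : t * (`|b| + 1) = e / 2 by rewrite divfK // gt_eqF.
(* The terms [t * b 0 j] keep [g] in the orthant; the default [e / 2] bounds the distance from [g]
   to the shifted point. *)
pose d := \big[Order.min/e / 2]_j (t * b 0 j).
have d0 : 0 < d by apply: lt_bigmin => [|j _]; rewrite ?divr_gt0 // mulr_gt0.
have [g Gg gd] := Gdense (v + t *: b) d d0; exists g; split=> // [j|].
  have dj : d <= t * b 0 j by exact: bigmin_le_cond.
  have := le_lt_trans (coord_le_norm _ j) gd; rewrite !mxE ltr_norml => /andP[_].
  by have := v0 j; lra.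
have -> : v - g = (v + t *: b - g) - t *: b by rewrite addrAC addrK.
apply: le_lt_trans (ler_normB _ _) _; rewrite normrZ (gtr0_norm t0).
have de : d <= e / 2 by exact: bigmin_le_id.
by move: tbe; rewrite mulrDr; lra.
Qed.

Theorem theorem3 (R : realType) (n : nat) (hn : (1 <= n)%N)
    (E : completeNormedModType R)
    (tau : Topological E) (htau : hausdorff_space (retopologize tau))
    (C : set E) (T : 'rV[R]_n -> E -> E) (hT : is_semigroup tau C T)
    (p : n.-tuple 'rV[R]_n)
    (hp : forall i : 'I_n, orthant R n (tnth p i)) (hfree : free p)
    (alpha : n.-tuple R) (halpha : rat_independent [tuple of 1 :: alpha])
    (p0 : 'rV[R]_n) (hp0 : p0 = \sum_(i < n) tnth alpha i *: tnth p i)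
    (hp0_orthant : orthant R n p0) :
  \bigcap_(q in orthant R n) fixed_points C (T q) =
  fixed_points C (T p0) `&` \bigcap_(i : 'I_n) fixed_points C (T (tnth p i)).
Proof.
apply/seteqP; split=> x /=.
  by move=> fix_x; split=> [|i _]; apply: fix_x; [exact: hp0_orthant | exact: hp].
move=> [[Cx p0x] fix_p] q q0; split=> //.
have sp0 : stabilizer T x p0 by [].
have sp i : stabilizer T x (tnth p i) by split=> //; have [] := fix_p i I.
(* Kronecker density applies to the periods of x, which contain [p0] and all the [p_i]. *)
have Gdense := basis_generates_dense hfree halpha (periods_subgroup hT Cx sp0)
  (fun i => stabilizer_periods hT Cx (sp i)).
rewrite -hp0 in Gdense.
have /dense_in_orthant := Gdense (stabilizer_periods hT Cx sp0).
move=> /(_ _ (basis_sum_gt0 hfree hp)) Gnear.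
apply: (proj2 (stabilizer_closed hT Cx htau q0 _)).
move=> e e0; have [g [Gg g0 qg]] := Gnear q e q0 e0.
by exists g => //; exact: (periods_orthant hT Cx Gg g0).
Qed.
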